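(* Let $(\gamma,\lambda/\mu)$ be a placed skew shape with $n$ boxes, and let $$J=\{\varepsilon_j-\varepsilon_i\mid j>i,\ \mathrm{box}_j\text{ and }\mathrm{box}_i\text{ are in adjacent diagonals, and }\mathrm{box}_j\text{ is northwest of }\mathrm{box}_i\}.$$ Let $\mathcal{F}^{\lambda/\mu}$ be the set of (classical) standard tableaux of shape $\lambda/\mu$, and let $\mathcal{F}^{(\gamma,J)}$ be the set of generalized standard tableaux of shape $(\gamma,J)$ for the root system of type $A_{n-1}$. Then the map $\mathcal{F}^{\lambda/\mu}\to\mathcal{F}^{(\gamma,J)}$, $t\mapsto w_t$, is a bijection.
   Context: Type $A_{n-1}$: $\{\varepsilon_1,\dots,\varepsilon_n\}$ is an orthonormal basis of $\mathbb{R}^n$, $R=\{\varepsilon_j-\varepsilon_i\mid i\ne j\}$, $R^+=\{\varepsilon_j-\varepsilon_i\mid 1\le i<j\le n\}$, and $W=S_n$ acts by $w\varepsilon_i=\varepsilon_{w(i)}$. The inversion set of $w\in S_n$ is $R(w)=\{\alpha\in R^+\mid w\alpha\in -R^+\}$. A vector $\gamma=(\gamma_1,\dots,\gamma_n)=\sum_i\gamma_i\varepsilon_i$ is dominant if $\gamma_1\le\dots\le\gamma_n$. For dominant $\gamma$: $Z(\gamma)=\{\alpha\in R^+\mid\langle\gamma,\alpha\rangle=0\}$, $P(\gamma)=\{\alpha\in R\mid\langle\gamma,\alpha\rangle=1\}$. For $J\subseteq P(\gamma)$, the set of generalized standard tableaux of shape $(\gamma,J)$ is $\mathcal{F}^{(\gamma,J)}=\{w\in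 W\mid R(w)\cap Z(\gamma)=\emptyset,\ R(w)\cap P(\gamma)=J\}$. A skew shape $\lambda/\mu$ (for partitions $\mu\subseteq\lambda$) is the set of boxes of $\lambda$ not in $\mu$; rows and columns are numbered as for matrices (rows downward, columns to the right). Diagonals run from northwest to southeast. The boxes of a skew shape with $n$ boxes are numbered $\mathrm{box}_1,\dots,\mathrm{box}_n$ along diagonals, taking the diagonals in order from southwest to northeast and, within each diagonal, going from northwest to southeast. The skew shape is placed on infinite graph paper whose diagonals are indexed consecutively by $\mathbb{Z}$, increasing from southwest to northeast (so the box in row $r$, column $c$ lies on the diagonal with index $c-r+\text{const}$); the content $c(b)$ of a box $b$ is the index of its diagonal. Put $\gamma=\sum_{i=1}^n c(\mathrm{box}_i)\varepsilon_i$; the pair $(\gamma,\lambda/\mu)$ is called a placed skew shape. Two diagonals are adjacent if their indices differ by $1$. ''Northwest'' means strictly north and weakly west. A (classical) standard tableau $t$ of shape $\lambda/\mu$ is a filling of its boxes with $1,\dots,n$, each used once, increasing from left to right in rows and from top to bottom in columns. Its word is the permutation $w_t\in S_n$ with $w_t(i)=t(\mathrm{box}_i)$, where $t(\mathrm{box}_i)$ is the entry in $\mathrm{box}_i$. *)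

(* Defs.v *)
From mathcomp Require Import all_boot all_order all_algebra all_fingroup.
From mathcomp Require Import zify.
From mathcomp Require Import boolp classical_sets functions reals.

Set Implicit Arguments.
Unset Strict Implicit.
Unset Printing Implicit Defensive.

Import Order.TTheory GRing.Theory Num.Theory.

Local Open Scope classical_set_scope.
Local Open Scope ring_scope.

Section RootSystemA.
Variables (R : realType) (n : nat).

Definition eps (i : 'I_n) : 'rV[R]_n := delta_mx 0 i.

Definition dotv (u v : 'rV[R]_n) : R := \sum_i u 0 i * v 0 i.

(* The linear action determined by w (eps i) = eps (w i). *)
Definition act (w : 'S_n) (v : 'rV[R]_n) : 'rV[R]_n :=
  \sum_i v 0 i *: eps (w i).

Definition roots : set 'rV[R]_n :=
  [set a | exists i j : 'I_n, i <> j /\ a = eps j - eps i].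

Definition pos_roots : set 'rV[R]_n :=
  [set a | exists i j : 'I_n, (i < j)%N /\ a = eps j - eps i].

Definition inversion_set (w : 'S_n) : set 'rV[R]_n :=
  [set a | pos_roots a /\ [set - b | b in pos_roots] (act w a)].

Definition dominant (g : 'rV[R]_n) : Prop :=
  forall i j : 'I_n, (i <= j)%N -> g 0 i <= g 0 j.

Definition Zset (g : 'rV[R]_n) : set 'rV[R]_n :=
  [set a | pos_roots a /\ dotv g a = 0].

Definition Pset (g : 'rV[R]_n) : set 'rV[R]_n :=
  [set a | roots a /\ dotv g a = 1].

Definition gen_tableaux (g : 'rV[R]_n) (J : set 'rV[R]_n) : set 'S_n :=
  [set w | inversion_set w `&` Zset g = set0 /\
           inversion_set w `&` Pset g = J].

Lemma act_eps (w : 'S_n) (i : 'I_n) : act w (eps i) = eps (w i).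
Proof.
rewrite /act (bigD1 i) //= !mxE !eqxx scale1r big1 ?addr0 // => j ji.
by rewrite !mxE (negPf ji) andbF scale0r.
Qed.

Lemma dotv_eps_sub (g : 'rV[R]_n) (i j : 'I_n) :
  dotv g (eps j - eps i) = g 0 j - g 0 i.
Proof.
have dE k : \sum_l g 0 l * eps k 0 l = g 0 k.
  rewrite (bigD1 k) //= !mxE !eqxx mulr1 big1 ?addr0 // => l lk.
  by rewrite !mxE (negPf lk) andbF mulr0.
rewrite -(dE j) -(dE i) -sumrB; apply: eq_bigr => l _.
by rewrite !mxE mulrBr.
Qed.

End RootSystemA.

Section SkewShapes.
Local Open Scope nat_scope.

Definition is_partition (la : seq nat) : bool := sorted geq la && (0 \notin la).

(* A box is a pair (row, column), both counted from 0. *)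
Definition diagram (la : seq nat) : seq (nat * nat) :=
  [seq (r, c) | r <- iota 0 (size la), c <- iota 0 (nth 0 la r)].

Definition part_sub (mu la : seq nat) : Prop :=
  {subset diagram mu <= diagram la}.

(* The comparison of diagonals c - r <= c' - r' without subtraction is
   c + r' <= c' + r; on a single diagonal, northwest to southeast is the order
   of the rows. *)
Definition diag_le (b b' : nat * nat) : bool :=
  (b.2 + b'.1 < b'.2 + b.1) || (b.2 + b'.1 == b'.2 + b.1) && (b.1 <= b'.1).

Definition boxes (la mu : seq nat) : seq (nat * nat) :=
  sort diag_le [seq b <- diagram la | b \notin diagram mu].

Definition nboxes (la mu : seq nat) : nat := size (boxes la mu).

Definition skew_box (la mu : seq nat) : finType := seq_sub (boxes la mu).

Lemma nth_box_subproof (la mu : seq nat) (i : 'I_(nboxes la mu)) :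
  tnth (in_tuple (boxes la mu)) i \in boxes la mu.
Proof. exact: mem_tnth. Qed.

Definition nth_box (la mu : seq nat) (i : 'I_(nboxes la mu)) : skew_box la mu :=
  SeqSub (nth_box_subproof i).

Definition row_of (la mu : seq nat) (b : skew_box la mu) : nat := (val b).1.
Definition col_of (la mu : seq nat) (b : skew_box la mu) : nat := (val b).2.

Definition northwest (la mu : seq nat) (b b' : skew_box la mu) : bool :=
  (row_of b < row_of b') && (col_of b <= col_of b').

(* Entries are 0, ..., n - 1 instead of 1, ..., n. *)
Definition is_standard (la mu : seq nat)
    (t : {ffun skew_box la mu -> 'I_(nboxes la mu)}) : bool :=
  [&& [forall k, #|[pred b | t b == k]| == 1],
      [forall b, forall b',
         (row_of b == row_of b') && (col_of b < col_of b') ==> (t b < t b')]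
    & [forall b, forall b',
         (col_of b == col_of b') && (row_of b < row_of b') ==> (t b < t b')]].

Definition std_tableau (la mu : seq nat) : finType :=
  {t : {ffun skew_box la mu -> 'I_(nboxes la mu)} | is_standard t}.

Lemma diag_le_trans : transitive diag_le.
Proof.
move=> b a c; rewrite /diag_le => /orP[ab|/andP[/eqP ab ab1]];
  move=> /orP[bc|/andP[/eqP bc bc1]]; apply/orP; lia.
Qed.

Lemma diag_le_total : total diag_le.
Proof. by move=> a b; rewrite /diag_le; lia. Qed.

Lemma nth_box_sorted (la mu : seq nat) (i j : 'I_(nboxes la mu)) :
  i <= j -> diag_le (val (nth_box i)) (val (nth_box j)).
Proof.
have diag_refl : reflexive diag_le by move=> a; rewrite /diag_le; lia.
move=> ij; rewrite /= !(tnth_nth (0, 0)) /=.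
have srt := sort_sorted diag_le_total
  [seq b <- diagram la | b \notin diagram mu].
by apply: (sorted_leq_nth diag_le_trans diag_refl (0, 0) srt);
  rewrite ?inE ?ltn_ord.
Qed.

Lemma uniq_boxes (la mu : seq nat) : uniq (boxes la mu).
Proof.
rewrite sort_uniq filter_uniq // allpairs_uniq_dep ?iota_uniq //.
  by move=> r _; apply: iota_uniq.
by move=> [r c] [r' c'] _ _ [-> ->].
Qed.

Lemma nth_box_inj (la mu : seq nat) : injective (@nth_box la mu).
Proof.
move=> i j /(congr1 val) /=; rewrite !(tnth_nth (0, 0)) /= => /eqP.
by rewrite nth_uniq ?uniq_boxes // => /eqP /val_inj.
Qed.

Lemma word_subproof (la mu : seq nat) (t : std_tableau la mu) :
  injective (fun i => val t (nth_box i)).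
Proof.
case/and3P: (valP t) => /forallP t1 _ _ i j /= tij.
apply: nth_box_inj; have /card1P[b bP] := t1 (val t (nth_box i)).
have := bP (nth_box i); have := bP (nth_box j).
by rewrite !inE tij eqxx => /esym/eqP -> /esym/eqP ->.
Qed.

Definition word (la mu : seq nat) (t : std_tableau la mu) : 'S_(nboxes la mu) :=
  perm (@word_subproof la mu t).

End SkewShapes.

Section PlacedShapes.
Variables (R : realType) (la mu : seq nat).

(* The integer k fixes the placement on the graph paper. *)
Variable k : int.

Definition content (b : skew_box la mu) : int :=
  (col_of b)%:Z - (row_of b)%:Z + k.

Definition content_vec : 'rV[R]_(nboxes la mu) :=
  \sum_i (content (nth_box i))%:~R *: eps R i.

Definition adjacent_diag (b b' : skew_box la mu) : Prop :=
  `|content b - content b'| = 1.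

Definition nw_roots : set 'rV[R]_(nboxes la mu) :=
  [set a | exists i j : 'I_(nboxes la mu),
     [/\ (i < j)%N,
         adjacent_diag (nth_box j) (nth_box i),
         northwest (nth_box j) (nth_box i)
       & a = eps R j - eps R i]].

Lemma content_vecE i : content_vec 0 i = (content (nth_box i))%:~R.
Proof.
rewrite summxE (bigD1 i) //= !mxE !eqxx mulr1 big1 ?addr0 // => j ji.
by rewrite !mxE eq_sym (negPf ji) andbF mulr0.
Qed.

Lemma content_vec_dominant : dominant content_vec.
Proof.
move=> i j /nth_box_sorted; rewrite !content_vecE ler_int /content.
rewrite /diag_le /row_of /col_of.
case: (val _) => r c; case: (val _) => r' c' /=; lia.
Qed.

Lemma nw_roots_sub : nw_roots `<=` Pset content_vec.
Proof.
move=> _ [i [j [ij adj nw ->]]]; split.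
  by exists i, j; split=> // eij; rewrite eij ltnn in ij.
rewrite dotv_eps_sub !content_vecE -intrB.
suff -> : content (nth_box j) - content (nth_box i) = 1 by [].
have := nth_box_sorted (ltnW ij); move: adj.
rewrite /adjacent_diag /content /diag_le /row_of /col_of.
case: (val _) => r c; case: (val _) => r' c' /=; lia.
Qed.

End PlacedShapes.

Arguments content_vec R la mu k : clear implicits.
Arguments nw_roots R la mu k : clear implicits.

(* Main.v *)
Require Import Defs.
From mathcomp Require Import all_boot all_order all_algebra all_fingroup.
From mathcomp Require Import zify.
From mathcomp Require Import boolp classical_sets functions reals.

(** For [i < j], the root [eps j - eps i] lies in [R(w)] iff [w j < w i], in
    [Z(gamma)] iff [box_i] and [box_j] share a diagonal, and in [P(gamma)] iff
    [box_j] is on the diagonal following that of [box_i].  Thus [w] is a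
    generalized tableau iff it increases along diagonals and, for [box_j] on
    the diagonal following that of [box_i], [w j < w i] exactly when [box_j] is
    northwest of [box_i].  A standard filling increases from a box to any other
    box weakly to its southeast, because a skew shape contains the corner of the
    path between them; this gives both conditions.  Conversely, horizontally or
    vertically consecutive boxes are on adjacent diagonals, so that the second
    condition orders their entries, and rows and columns of a skew shape have no
    gaps. *)

Import Order.TTheory GRing.Theory Num.Theory.

Local Open Scope classical_set_scope.
Local Open Scope ring_scope.

(** * Roots of type A in coordinates, and inversions of a permutation *)

Section RootsA.
Variables (R : realType) (n : nat).
Implicit Types (i j : 'I_n) (w : 'S_n).

(** Coordinate [i] of the left side is -1, which on the right only [i'] can produce since -1 differs
    from 0 and 1; coordinate [j] then identifies [j']. *)
Lemma eps_sub_inj i j i' j' : i <> j ->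
  eps R j - eps R i = eps R j' - eps R i' -> i = i' /\ j = j'.
Proof.
move=> /eqP ij e.
have two0 : (1 : R) + 1 != 0 by rewrite -(natrD R 1 1) pnatr_eq0.
have one0 := oner_neq0 R.
have ji : (j == i) = false by rewrite eq_sym (negPf ij).
have := congr1 (fun v : 'rV[R]_n => v 0 j) e.
have := congr1 (fun v : 'rV[R]_n => v 0 i) e.
rewrite !mxE !eqxx (negPf ij) ji /= subr0 sub0r.
case: (i =P i') => [<-|_]; last first.
  case: (i == j') => /=; rewrite subr0 => /esym/eqP.
    by rewrite -addr_eq0 (negPf two0).
  by rewrite eq_sym oppr_eq0 (negPf one0).
move=> _; case: (j =P j') => [//|_].
by rewrite ji subrr => /eqP; rewrite (negPf one0).
Qed.

Lemma pos_roots_eps i j : pos_roots (eps R j - eps R i) <-> (i < j)%N.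
Proof.
split=> [[i' [j' [ij /esym e]]]|ij]; last by exists i, j.
have ij' : i' <> j' by move=> eij; rewrite eij ltnn in ij.
by have [<- <-] := eps_sub_inj _ _ _ _ ij' e.
Qed.

Lemma act_eps_sub w i j :
  Defs.act w (eps R j - eps R i) = eps R (w j) - eps R (w i).
Proof.
rewrite -!act_eps -sumrB; apply: eq_bigr => l _.
by rewrite !mxE scalerBl.
Qed.

Lemma inversion_set_eps w i j :
  inversion_set w (eps R j - eps R i) <-> (i < j)%N /\ (w j < w i)%N.
Proof.
rewrite /inversion_set /= act_eps_sub pos_roots_eps; split=> -[ij].
  case=> b /= bpos e; split=> //; apply/pos_roots_eps.
  by rewrite -opprB -e opprK.
by move=> wij; split=> //; exists (eps R (w i) - eps R (w j));
  rewrite ?opprB //; apply/pos_roots_eps.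
Qed.

End RootsA.

(** * Convexity of skew shapes and monotonicity of fillings *)

Section SkewShape.
Local Open Scope nat_scope.
Variables (la mu : seq nat).
Implicit Types (b : skew_box la mu) (i j : 'I_(nboxes la mu)).

(** Parts past the end read as the default 0, so monotonicity extends to all row indices. *)
Lemma nth_partition_leq (nu : seq nat) r r' : is_partition nu -> r <= r' ->
  nth 0 nu r' <= nth 0 nu r.
Proof.
case/andP=> srt _ rr'; have [sz|sz] := ltnP r' (size nu); last first.
  by rewrite nth_default.
have geq_trans : transitive geq by move=> x y z /= yx zx; apply: leq_trans yx.
have := sorted_leq_nth geq_trans (fun x => leqnn x) 0 srt r r'.
by rewrite !inE; apply=> //; apply: leq_ltn_trans sz.
Qed.

Lemma mem_diagram (nu : seq nat) r c :
  ((r, c) \in diagram nu) = (c < nth 0 nu r).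
Proof.
apply/allpairsPdep/idP => [[r' [c' [_ + [-> ->]]]]|cr].
  by rewrite mem_iota.
exists r, c; rewrite !mem_iota /= add0n; split=> //.
by rewrite ltnNge; apply: contraTN cr => sz; rewrite nth_default.
Qed.

Lemma mem_boxes r c :
  ((r, c) \in boxes la mu) = (nth 0 mu r <= c < nth 0 la r).
Proof. by rewrite mem_sort mem_filter !mem_diagram -leqNgt. Qed.

(** Inverse of [nth_box]; it lets a permutation be read as a filling of the boxes. *)
Definition box_index (b : skew_box la mu) : 'I_(nboxes la mu) :=
  Ordinal (etrans (index_mem (val b) (boxes la mu)) (valP b)).

Lemma box_indexK : cancel box_index (@nth_box la mu).
Proof.
by move=> b; apply: val_inj; rewrite /= (tnth_nth (0, 0)) /= nth_index ?(valP b).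
Qed.

Lemma nth_boxK : cancel (@nth_box la mu) box_index.
Proof. by move=> i; apply: nth_box_inj; rewrite box_indexK. Qed.

(** The hypothesis compares contents, written without subtraction: the diagonal of [b] lies strictly
    southwest of that of [b']. *)
Lemma box_index_ltn b b' :
  col_of b + row_of b' < col_of b' + row_of b -> box_index b < box_index b'.
Proof.
move=> lt; rewrite ltnNge; apply: contraTN lt => /nth_box_sorted.
rewrite !box_indexK /diag_le /col_of /row_of.
by case: (val b) (val b') => [? ?] [? ?] /=; lia.
Qed.

(** Going down from the row of [b], parts of [mu] do not grow, so [c] stays outside [mu]; going up
    from the row of [b'], parts of [la] do not shrink, so [c] stays inside [la]. *)
Lemma skew_convex b b' r c : is_partition la -> is_partition mu ->
    row_of b <= r <= row_of b' -> col_of b <= c <= col_of b' ->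
  exists2 b0 : skew_box la mu, row_of b0 = r & col_of b0 = c.
Proof.
move=> hla hmu /andP[br rb] /andP[bc cb].
have rc : (r, c) \in boxes la mu.
  rewrite mem_boxes.
  have := nth_partition_leq _ _ _ hla rb; have := nth_partition_leq _ _ _ hmu br.
  move: bc cb (valP b) (valP b'); rewrite /row_of /col_of.
  by case: (val b) (val b') => [x y] [x' y']; rewrite !mem_boxes /=; lia.
by exists (SeqSub rc).
Qed.

Lemma skew_box_eq b b' : row_of b = row_of b' -> col_of b = col_of b' -> b = b'.
Proof.
move=> er ec; apply: val_inj; move: er ec; rewrite /row_of /col_of.
by case: (val b) (val b') => [? ?] [? ?] /= -> ->.
Qed.

Lemma standard_ltn (t : {ffun skew_box la mu -> 'I_(nboxes la mu)}) b b' :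
    is_partition la -> is_partition mu -> is_standard t ->
    row_of b <= row_of b' -> col_of b <= col_of b' -> b != b' ->
  t b < t b'.
Proof.
move=> hla hmu /and3P[_ /forallP trow /forallP tcol] br bc bb'.
(* The corner of the path that goes right from [b] and then down to [b']; it may coincide with
   either end. *)
have [b0 r0 c0] : exists2 b0 : skew_box la mu,
    row_of b0 = row_of b & col_of b0 = col_of b'.
  by apply: (skew_convex b b'); rewrite // ?leqnn ?br ?bc.
have tbb0 : (col_of b < col_of b') -> t b < t b0.
  move=> lt; have /forallP/(_ b0)/implyP := trow b.
  by apply; rewrite r0 c0 eqxx.
have tb0b' : (row_of b < row_of b') -> t b0 < t b'.
  move=> lt; have /forallP/(_ b')/implyP := tcol b0.
  by apply; rewrite r0 c0 eqxx.
move: br bc; rewrite leq_eqVlt => /predU1P[er|lr].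
  rewrite leq_eqVlt => /predU1P[ec|lc].
    by rewrite (skew_box_eq _ _ er ec) eqxx in bb'.
  by rewrite -(skew_box_eq b0 b') ?r0 ?er //; apply: tbb0.
rewrite leq_eqVlt => /predU1P[ec|lc].
  by rewrite (skew_box_eq b b0) ?r0 ?c0 //; apply: tb0b'.
by apply: ltn_trans (tbb0 lc) (tb0b' lr).
Qed.

Lemma row_ltn (f : skew_box la mu -> nat) : is_partition la -> is_partition mu ->
    (forall b b', row_of b' = row_of b -> col_of b' = (col_of b).+1 ->
       f b < f b') ->
  forall b b', row_of b = row_of b' -> col_of b < col_of b' -> f b < f b'.
Proof.
move=> hla hmu fS b b' er lc.
(* Writing the gap as [d.+1] makes neighbouring boxes the base case; convexity supplies the box just
   before [b']. *)
have [d ed] : exists d, col_of b' = col_of b + d.+1.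
  by exists (col_of b' - (col_of b).+1); lia.
elim: d b' ed er {lc} => [|d IHd] b' ed er; first by apply: fS; lia.
have [||b0 r0 c0] := skew_convex b b' (row_of b) (col_of b + d.+1) hla hmu.
- lia.
- lia.
by apply: ltn_trans (IHd b0 c0 (esym r0)) (fS _ _ _ _); lia.
Qed.

Lemma col_ltn (f : skew_box la mu -> nat) : is_partition la -> is_partition mu ->
    (forall b b', col_of b' = col_of b -> row_of b' = (row_of b).+1 ->
       f b < f b') ->
  forall b b', col_of b = col_of b' -> row_of b < row_of b' -> f b < f b'.
Proof.
move=> hla hmu fS b b' ec lr.
have [d ed] : exists d, row_of b' = row_of b + d.+1.
  by exists (row_of b' - (row_of b).+1); lia.
elim: d b' ed ec {lr} => [|d IHd] b' ed ec; first by apply: fS; lia.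
have [||b0 r0 c0] := skew_convex b b' (row_of b + d.+1) (col_of b) hla hmu.
- lia.
- lia.
by apply: ltn_trans (IHd b0 r0 (esym c0)) (fS _ _ _ _); lia.
Qed.

End SkewShape.

(** * Generalized tableaux as order conditions on words *)

Section PlacedShape.
Variables (R : realType) (la mu : seq nat) (k : int).
Implicit Types (i j : 'I_(nboxes la mu)) (w : 'S_(nboxes la mu)).

(** Integers embed injectively in [R]. The case [m = 0] describes [Zset] and [m = 1] describes
    [Pset]. *)
Lemma dotv_content_vec i j (m : int) :
  dotv (content_vec R la mu k) (eps R j - eps R i) = m%:~R <->
  content k (nth_box j) = content k (nth_box i) + m.
Proof.
rewrite dotv_eps_sub !content_vecE -intrB.
split=> [/eqP|->]; last by rewrite addrAC subrr add0r.
by rewrite eqr_int subr_eq addrC => /eqP.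
Qed.

(** Adjacency is symmetric, but roots of J pair to 1 with the content vector, which fixes its
    direction; the indices are recovered from the root by [eps_sub_inj]. *)
Lemma nw_roots_eps i j :
  nw_roots R la mu k (eps R j - eps R i) <->
  [/\ (i < j)%N, content k (nth_box j) = content k (nth_box i) + 1
    & northwest (nth_box j) (nth_box i)].
Proof.
split=> [aJ|[ij cij nw]].
  have [_ /(dotv_content_vec i j 1) cij] := nw_roots_sub aJ.
  case: aJ => i' [j' [ij' _ nw /esym e]].
  have neq' : i' <> j' by move=> eij; rewrite eij ltnn in ij'.
  by have [ei ej] := eps_sub_inj _ _ _ _ _ _ neq' e; move: cij; rewrite -ei -ej.
exists i, j; split=> //.
by rewrite /adjacent_diag cij addrAC subrr add0r normr1.
Qed.

Lemma gen_tableauxP w :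
  gen_tableaux (content_vec R la mu k) (nw_roots R la mu k) w <->
  (forall i j, (i < j)%N -> content k (nth_box j) = content k (nth_box i) ->
     (w i < w j)%N) /\
  (forall i j, (i < j)%N -> content k (nth_box j) = content k (nth_box i) + 1 ->
     (w j < w i)%N = northwest (nth_box j) (nth_box i)).
Proof.
split=> -[wZ wP]; split.
- move=> i j ij cij; rewrite ltnNge leq_eqVlt negb_or -leqNgt; apply/andP; split.
    by apply/eqP => /val_inj/perm_inj eij; rewrite eij ltnn in ij.
  rewrite leqNgt; apply/negP => wij.
  suff : (inversion_set w `&` Zset (content_vec R la mu k))
      (eps R j - eps R i) by rewrite wZ.
  split; first by apply/inversion_set_eps.
  split; first exact/pos_roots_eps.
  by apply/(dotv_content_vec i j 0); rewrite addr0.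
- move=> i j ij cij; apply/idP/idP => [wij|nw].
    suff : nw_roots R la mu k (eps R j - eps R i) by case/nw_roots_eps.
    rewrite -wP; split; first by apply/inversion_set_eps.
    split; last exact/(dotv_content_vec i j 1).
    by exists i, j; split=> // eij; rewrite eij ltnn in ij.
  have : nw_roots R la mu k (eps R j - eps R i) by apply/nw_roots_eps.
  by rewrite -wP => -[/inversion_set_eps[]].
- rewrite -subset0 => a [aw [[i [j [ij ea]]]]]; move: aw; rewrite ea.
  move=> /inversion_set_eps[_ wij] /(dotv_content_vec i j 0).
  rewrite addr0 => cij.
  by have := ltn_trans wij (wZ _ _ ij cij); rewrite ltnn.
- apply/seteqP; split=> a.
    (* [Pset] ranges over all roots; being an inversion is what makes this one positive. *)
    case=> aw [[i [j [_ ea]]]]; move: aw; rewrite ea.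
    move=> /inversion_set_eps[ij wij] /(dotv_content_vec i j 1) cij.
    by apply/nw_roots_eps; rewrite -wP.
  move=> aJ; have [i [j [ij _ _ ea]]] := aJ; split; last exact: nw_roots_sub aJ.
  move: aJ; rewrite ea => /nw_roots_eps[_ cij nw].
  by apply/inversion_set_eps; rewrite wP.
Qed.

(** * Passing between standard fillings and generalized tableaux *)

Lemma word_gen_tableaux (t : std_tableau la mu) :
    is_partition la -> is_partition mu ->
  gen_tableaux (content_vec R la mu k) (nw_roots R la mu k) (word t).
Proof.
move=> hla hmu; apply/gen_tableauxP.
have neq_box i j : (i < j)%N -> nth_box i != nth_box j.
  by move=> ij; rewrite (inj_eq (@nth_box_inj _ _)) neq_ltn ij.
split=> i j ij cij; rewrite !permE.
  have := nth_box_sorted (ltnW ij); move: cij.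
  rewrite /content /diag_le => cij le_ij.
  by apply: standard_ltn (valP t) _ _ (neq_box _ _ ij) => //;
    move: cij le_ij; rewrite /row_of /col_of;
    case: (val _) (val (nth_box j)) => [? ?] [? ?] /=; lia.
move: cij; rewrite /content => cij.
apply/idP/idP => [|/andP[rji cji]].
  (* On consecutive diagonals, if box [j] is not northwest of box [i], then it is weakly south and
     strictly east of it, so its entry is larger. *)
  apply: contraLR; rewrite -leqNgt /northwest => nw.
  by apply/ltnW/standard_ltn; rewrite ?(valP t) ?neq_box //; lia.
by apply: standard_ltn; rewrite ?(valP t) 1?eq_sym ?neq_box //; lia.
Qed.

Lemma word_inj : injective (@word la mu).
Proof.
move=> t t' e; apply/val_inj/ffunP => b; rewrite -(box_indexK _ _ b).
by have := congr1 (fun w : 'S__ => w (box_index la mu b)) e; rewrite !permE.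
Qed.

Lemma gen_tableaux_standard w : is_partition la -> is_partition mu ->
    gen_tableaux (content_vec R la mu k) (nw_roots R la mu k) w ->
  is_standard [ffun b => w (box_index la mu b)].
Proof.
move=> hla hmu /gen_tableauxP[_ wP].
have wbox b b' : (box_index la mu b < box_index la mu b')%N ->
    content k b' = content k b + 1 ->
    (w (box_index la mu b') < w (box_index la mu b))%N = northwest b' b.
  by move=> /wP; rewrite !box_indexK.
apply/and3P; split.
- apply/forallP => l; apply/eqP/(eq_card1 (x := nth_box (w^-1 l)%g)) => b.
  rewrite !inE ffunE; apply/eqP/eqP => [<-|->].
    by rewrite permK box_indexK.
  by rewrite nth_boxK permKV.
- apply/forallP => b; apply/forallP => b'; rewrite !ffunE.
  apply/implyP => /andP[/eqP er lc].
  apply: (row_ltn _ _ (fun b => w (box_index la mu b)) hla hmu _ _ _ er lc).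
  (* The right neighbour [b'] is on the next diagonal and, being in the same row, not northwest of
     [b]; this gives the weak inequality, and injectivity of [w] makes it strict. *)
  move=> {er lc} {}b {}b' er ec; rewrite ltn_neqAle leqNgt wbox; last first.
  + by rewrite /content er ec; lia.
  + by apply: box_index_ltn; lia.
  rewrite /northwest er ltnn andbT (inj_eq val_inj) (inj_eq perm_inj).
  by apply/eqP => /(can_inj (box_indexK _ _)) eb; move: ec; rewrite eb; lia.
- apply/forallP => b; apply/forallP => b'; rewrite !ffunE.
  apply/implyP => /andP[/eqP ec lr].
  apply: (col_ltn _ _ (fun b => w (box_index la mu b)) hla hmu _ _ _ ec lr).
  (* The roles swap here: the upper box [b] is on the diagonal after that of [b'], and it is
     northwest of [b'] because northwest allows equal columns. *)
  move=> {ec lr} {}b {}b' ec er; rewrite wbox.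
  + by rewrite /northwest er ec leqnn leqnn.
  + by apply: box_index_ltn; lia.
  + by rewrite /content er ec; lia.
Qed.

End PlacedShape.

Theorem theorem3p5 (R : realType) (la mu : seq nat) (k : int)
    (hla : is_partition la) (hmu : is_partition mu) (hsub : part_sub mu la) :
  set_bij [set: std_tableau la mu]
          (gen_tableaux (content_vec R la mu k) (nw_roots R la mu k))
          (@word la mu).
Proof.
split=> [t _|t t' _ _|w wF]; first exact: word_gen_tableaux.
  exact: word_inj.
have std := gen_tableaux_standard R la mu k w hla hmu wF.
(* The preimage of [w] puts the entry [w i] in box [i]. *)
exists (exist (fun t => is_true (is_standard t)) _ std) => //.
by apply/permP => i; rewrite permE /= ffunE nth_boxK.
Qed.
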